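(* $\mathsf{in}_t(K_4)\ge 4$.
   Context: Zero-visibility $k$-search game on a finite simple graph $G$: an invisible intruder occupies a vertex; players alternate starting with the searcher; on each turn the searcher inspects an arbitrary set of $k$ vertices and wins if the intruder is at one of them; otherwise the intruder may move to an adjacent vertex or stay. The inspection number $\mathsf{in}(G)$ is the least $k$ for which the searcher has a finite sequence of moves guaranteeing capture. A subdivision of $G$ is obtained by repeatedly replacing an edge by a path of length two through a new vertex. $\mathsf{in}_t(G)$ is the least $k$ such that every subdivision $H$ of $G$ has a further subdivision $H'$ with $\mathsf{in}(H')\le k$. *)

(* Defs.v *)
From HB Require Import structures.
From mathcomp Require Import all_boot.
From mathcomp Require Import boolp.
From mathcomp Require Import zify.

Set Implicit Arguments.
Unset Strict Implicit.
Unset Printing Implicit Defensive.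

Record sgraph := SGraph {
  vertex :> finType;
  adj : rel vertex;
  adj_sym : symmetric adj;
  adj_irrefl : irreflexive adj }.

Definition complete_rel n : rel 'I_n := fun x y => x != y.

Lemma complete_sym n : symmetric (@complete_rel n).
Proof. by move=> x y; rewrite /complete_rel eq_sym. Qed.

Lemma complete_irrefl n : irreflexive (@complete_rel n).
Proof. by move=> x; rewrite /complete_rel eqxx. Qed.

Definition complete_graph (n : nat) : sgraph :=
  SGraph (@complete_sym n) (@complete_irrefl n).

(* [w i] is the position of the intruder when the i-th inspection takes place. *)
Definition trajectory (G : sgraph) (w : nat -> G) : Prop :=
  forall i, w i.+1 = w i \/ adj (w i) (w i.+1).

(* The intruder being invisible, the searcher gets no information before the
   capture, so a strategy is a fixed sequence of inspected sets. *)
Definition captures (G : sgraph) (s : seq {set G}) : Prop :=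
  forall w : nat -> G, trajectory w ->
    exists2 i, i < size s & w i \in nth set0 s i.

Definition searcher_wins (G : sgraph) (k : nat) : Prop :=
  exists2 s : seq {set G}, captures s & all (fun A : {set G} => #|A| == k) s.

Lemma searcher_wins_card (G : sgraph) : searcher_wins G #|G|.
Proof.
exists [:: [set: G]]; last by rewrite /= cardsT eqxx.
by move=> w _; exists 0; rewrite //= in_setT.
Qed.

Lemma inspection_ex (G : sgraph) : exists k, `[< searcher_wins G k >].
Proof. by exists #|G|; apply/asboolP/searcher_wins_card. Qed.

Definition inspection_number (G : sgraph) : nat := ex_minn (inspection_ex G).

Lemma inspection_number_leq (G : sgraph) k :
  searcher_wins G k -> inspection_number G <= k.
Proof.
by move=> /asboolP wk; rewrite /inspection_number; case: ex_minnP => m _; apply.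
Qed.

(* The edge uv is replaced by the path u, None, v. *)
Definition subdivide_rel (G : sgraph) (u v : G) : rel (option G) :=
  fun x y => match x, y with
  | Some a, Some b => adj a b && ([set a; b] != [set u; v])
  | Some a, None | None, Some a => a \in [set u; v]
  | None, None => false
  end.

Lemma subdivide_sym (G : sgraph) (u v : G) : symmetric (subdivide_rel u v).
Proof. by move=> [a|] [b|] //=; rewrite adj_sym setUC. Qed.

Lemma subdivide_irrefl (G : sgraph) (u v : G) : irreflexive (subdivide_rel u v).
Proof. by move=> [a|] //=; rewrite adj_irrefl. Qed.

Definition subdivide_edge (G : sgraph) (u v : G) : sgraph :=
  SGraph (@subdivide_sym G u v) (@subdivide_irrefl G u v).

(* A graph is a subdivision of itself. *)
Inductive subdivision (G : sgraph) : sgraph -> Prop :=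
| Subdivision_refl : subdivision G G
| Subdivision_edge (H : sgraph) (u v : H) :
    subdivision G H -> adj u v -> subdivision G (subdivide_edge u v).

Definition subdivisions_bounded (G : sgraph) (k : nat) : Prop :=
  forall H, subdivision G H ->
    exists2 H', subdivision H H' & inspection_number H' <= k.

(* Some k bounds the inspection number of all subdivisions of G: away from the
   branch vertices B a subdivision is a disjoint union of paths, laid out by f
   along the line; inspecting B throughout, the searcher sweeps the line with
   two more vertices. *)
Definition path_layout (m : nat) (H : sgraph) : Prop :=
  exists (B : {set H}) (f : H -> nat),
  [/\ #|B| <= m,
      {in ~: B &, injective f},
      forall x a b c, x \notin B -> adj x a -> adj x b -> adj x c ->
        [\/ a = b, a = c | b = c] &
      forall x y, x \notin B -> y \notin B -> adj x y ->
        f x = (f y).+1 \/ f y = (f x).+1].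

Lemma card_superset (T : finType) (A : {set T}) k :
  #|A| <= k <= #|T| -> exists2 C : {set T}, A \subset C & #|C| = k.
Proof.
elim: k => [|k IH] /andP[Ak kT].
  by exists A => //; apply/eqP; rewrite -leqn0.
case: (ltngtP #|A| k.+1) Ak => // [Ak|Ak] _; last by exists A.
have [|C AC Ck] := IH; first by lia.
have : 0 < #|~: C| by rewrite cardsCs setCK; lia.
case/card_gt0P => x; rewrite inE => xC; exists (x |: C).
  exact: subset_trans AC (subsetUr _ _).
by rewrite cardsU1 xC Ck.
Qed.

Lemma searcher_wins_sub (G : sgraph) (s : seq {set G}) k :
  captures s -> all (fun A : {set G} => #|A| <= k) s ->
  inspection_number G <= k.
Proof.
move=> cs /allP sk.
case: (leqP #|G| k) => [Gk|kG].
  exact: leq_trans (inspection_number_leq (searcher_wins_card G)) Gk.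
apply: inspection_number_leq.
have F (A : {set G}) : exists C : {set G}, #|A| <= k -> A \subset C /\ #|C| = k.
  case: (leqP #|A| k) => [Ak|]; last by exists A.
  by have [|C ? ?] := @card_superset _ A k; [rewrite Ak ltnW | exists C].
have [g gP] := choice F.
exists (map g s).
  move=> w /cs[i si wi]; exists i; rewrite ?size_map // (nth_map set0) //.
  have [/subsetP sub _] := gP _ (sk _ (mem_nth set0 si)); exact: sub.
by apply/allP => _ /mapP[A As ->]; apply/eqP; have [] := gP _ (sk _ As).
Qed.

Lemma path_layout_bound m H : path_layout m H -> inspection_number H <= m.+2.
Proof.
move=> [B [f [Bm inj _ cons]]].
pose L n := [set x in ~: B | f x == n].
pose S n := B :|: L n :|: L n.+1.
pose N := (\max_(x : H) f x).+1.
have L1 n : #|L n| <= 1.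
  apply/card_le1P => x; rewrite !inE => /andP[xB /eqP fx] y.
  rewrite !inE; apply/idP/idP => [/andP[yB /eqP fy]|/eqP->].
    by apply/eqP; apply: inj; rewrite ?inE // fx.
  by rewrite fx eqxx andbT.
apply: (@searcher_wins_sub _ (mkseq S N.+1)); last first.
  apply/allP => _ /mapP[n _ ->]; rewrite /S.
  have := cardsUI (B :|: L n) (L n.+1); have := cardsUI B (L n).
  have := L1 n; have := L1 n.+1; lia.
move=> w tw; case: (pselect (exists2 i, i < N.+1 & w i \in S i)) => [[i iN wi]|no].
  by exists i; rewrite ?size_mkseq // nth_mkseq.
have {}no i : i < N.+1 -> w i \notin S i by move=> iN; apply/negP => ?; apply: no; exists i.
have far t : t < N.+1 -> w t \notin B /\ t.+1 < f (w t).
  elim: t => [|t IH] tN; have := no _ tN; rewrite !inE.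
    by case: (w 0 \in B) => //= nf; split=> //; lia.
  have [wB wf] := IH (ltnW tN).
  case: (boolP (_ \in B)) => //= wB' nf; split=> //.
  case: (tw t) => [e|/(cons _ _ wB wB')]; last by lia.
  by move: nf; rewrite e; lia.
have [_ h] := far N (ltnSn N).
have : f (w N) <= \max_(x : H) f x by apply: leq_bigmax.
by rewrite /N in h *; lia.
Qed.

Lemma path_layout_self (G : sgraph) : path_layout #|G| G.
Proof.
exists [set: G], (fun=> 0); split; rewrite ?cardsT // => x; rewrite ?inE //.
Qed.

Lemma path_layout_edge m (H : sgraph) (u v : H) :
  adj u v -> path_layout m H -> path_layout m (subdivide_edge u v).
Proof.
move=> uv [B [f [Bm inj deg cons]]].
have [p [pcut pnew]] : exists p,
    (forall x y, x \notin B -> y \notin B -> adj x y ->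
       [set x; y] != [set u; v] -> (f x).+1 = p -> f y = p -> False) /\
    (forall x, x \notin B -> x \in [set u; v] -> f x = p \/ (f x).+1 = p).
  have half (a b : H) : adj a b -> a \notin B -> b \in B -> exists p,
    (forall x y, x \notin B -> y \notin B -> adj x y -> (f x).+1 = p -> f y = p -> False) /\
    (forall x, x \notin B -> x \in [set a; b] -> f x = p \/ (f x).+1 = p).
    move=> ab aB bB.
    have new q : f a = q \/ (f a).+1 = q ->
        forall x, x \notin B -> x \in [set a; b] -> f x = q \/ (f x).+1 = q.
      by move=> aq x xB /set2P[->//|xb]; rewrite xb bB in xB.
    case: (pselect (exists c, [/\ c \notin B, adj a c & f c = (f a).+1])) => [[c [cB ac fc]]|no].
      exists (f a); split; last by apply: new; left.
      move=> x y xB yB xy fx fy.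
      have ya : y = a by apply: inj; rewrite ?inE.
      rewrite {}ya adj_sym in xy.
      case: (deg _ _ _ _ aB ab ac xy) => e.
      - by rewrite -e bB in cB.
      - by rewrite -e bB in xB.
      - by rewrite -e in fx; lia.
    exists (f a).+1; split; last by apply: new; right.
    move=> x y xB yB xy [fx] fy; apply: no; exists y.
    have xa : x = a by apply: inj; rewrite ?inE.
    by rewrite -xa in fy *; split; rewrite ?fy ?fx.
  case: (boolP (u \in B)) => uB; case: (boolP (v \in B)) => vB.
  - exists 0; split=> // x xB /set2P[] e; by rewrite e ?uB ?vB in xB.
  - have [||//|q [q1 q2]] := half v u; rewrite ?(adj_sym v) //.
    exists q; split; last by rewrite setUC.
    by move=> x y *; apply: (q1 x y).
  - have [//|//|//|q [q1 q2]] := half u v.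
    by exists q; split=> // x y *; apply: (q1 x y).
  - have c := cons _ _ uB vB uv.
    exists (maxn (f u) (f v)); split; last by move=> x _ /set2P[] ->; lia.
    move=> x y xB yB xy ne fx fy; move/negP: ne; apply; apply/eqP.
    case: c => c.
    + have -> : x = v by apply: inj; rewrite ?inE //; lia.
      have -> : y = u by apply: inj; rewrite ?inE //; lia.
      exact: setUC.
    + have -> : x = u by apply: inj; rewrite ?inE //; lia.
      by have -> : y = v by apply: inj; rewrite ?inE //; lia.
pose sh n := if n < p then n else n.+1.
pose g (x : option H) := if x is Some a then sh (f a) else p.
have SB (x : H) : (Some x \in [set Some b | b in B]) = (x \in B).
  by apply: mem_imset => ? ? [].
have sh_inj : injective sh.
  by move=> i j; rewrite /sh; do 2!case: ifP; lia.
have sh_p n : sh n <> p by rewrite /sh; case: ifP; lia.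
exists [set Some b | b in B], g; split.
- by rewrite card_imset // => ? ? [].
- move=> [x|] [y|]; rewrite !inE ?SB //= => xB yB.
  + by move/sh_inj => e; congr Some; apply: inj; rewrite ?inE.
  + by move/sh_p.
  + by move/esym/sh_p.
- move=> [x|] a b c; last first.
    case: a b c => [a|] [b|] [c|] //= _ /set2P[] -> /set2P[] -> /set2P[] ->;
      by [left | right; left | constructor 1 | constructor 2 | constructor 3].
  rewrite SB => xB.
  pose h (y : option H) := if y is Some z then z else if x == u then v else u.
  have hadj y : subdivide_rel u v (Some x) y -> adj x (h y).
    case: y => [y|] /=; first by case/andP.
    case/set2P => ->; rewrite ?eqxx //.
    case: eqP => [vu|_]; last by rewrite adj_sym.
    by rewrite -[X in adj X _]vu in uv *; rewrite vu in uv *.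
  have hne y : subdivide_rel u v (Some x) (Some y) -> x \in [set u; v] ->
      y <> h None.
    move=> /= /andP[_ /negP ne] xuv e; apply: ne; rewrite e /=.
    case: (x =P u) xuv => [-> //|xu /set2P[//|->]]; by rewrite setUC.
  have hinj y z : subdivide_rel u v (Some x) y -> subdivide_rel u v (Some x) z ->
      h y = h z -> y = z.
    case: y z => [y|] [z|] //.
    + by move=> _ _ /= ->.
    + by move=> xy xn e; case: (hne _ xy xn).
    + by move=> xn xz e; case: (hne _ xz xn).
  move=> xa xb xc.
  case: (deg _ _ _ _ xB (hadj _ xa) (hadj _ xb) (hadj _ xc)) => e;
    [constructor 1 | constructor 2 | constructor 3]; exact: hinj e.
- move=> [x|] [y|] //=; rewrite ?SB => xB yB.
  + case/andP=> xy ne; have := cons _ _ xB yB xy.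
    have c1 := pcut x y xB yB xy ne.
    have c2 : (f y).+1 = p -> f x = p -> False.
      by apply: pcut => //; rewrite 1?adj_sym // setUC.
    by rewrite /sh; do 2!case: ifP; lia.
  + by move=> /(pnew _ xB); rewrite /sh; case: ifP; lia.
  + by move=> /(pnew _ yB); rewrite /sh; case: ifP; lia.
Qed.

Lemma topological_inspection_ex (G : sgraph) :
  exists k, `[< subdivisions_bounded G k >].
Proof.
exists #|G|.+2; apply/asboolP => H GH; exists H; first exact: Subdivision_refl.
apply: path_layout_bound; elim: GH => [|H' u v _ IH uv].
  exact: path_layout_self.
exact: path_layout_edge.
Qed.

Definition topological_inspection_number (G : sgraph) : nat :=
  ex_minn (topological_inspection_ex G).

(* Main.v *)
(* A cleaned set of vertices, joined with an inspected triple, becomes D, and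
   then shrinks to the interior of D: it cannot grow unless D has at most two
   boundary vertices. Every subdivision of K4 contains three blobs joining two
   hubs (a theta graph, one path of which may carry a pendant path). At most two
   boundary vertices force the interior of D or the complement of D into a
   single blob. When the sizes of the blobs satisfy the strict triangle
   inequality with a little slack, such a D is too small or too large for the
   cleaned set ever to exceed the largest blob. The lengths of the edges of the
   subdivision being arbitrary, the pendant path is a truncation of an edge,
   chosen so as to balance the blobs: in the whole graph, one very long edge
   would violate the triangle inequality. *)

Require Import Defs.
From mathcomp Require Import all_boot.
From mathcomp Require Import boolp zify.

Set Implicit Arguments.
Unset Strict Implicit.
Unset Printing Implicit Defensive.

(** * Evasion from an isoperimetric inequality *)

(** For an intruder confined to [W] and only known to be outside [D], with [D] inside [W], these are
    the vertices of [W] where he cannot be after his next move. *)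
Definition interior (G : sgraph) (W D : {set G}) : {set G} :=
  [set x in D | [forall (y | y \in W), adj x y ==> (y \in D)]].

Lemma interiorP (G : sgraph) (W D : {set G}) x :
  reflect (x \in D /\ forall y, y \in W -> adj x y -> y \in D)
          (x \in interior W D).
Proof.
rewrite inE; apply: (iffP andP) => -[xD h]; split=> //.
  by move=> y yW xy; move/forall_inP: h => /(_ y yW) /implyP; apply.
by apply/forall_inP => y yW; apply/implyP; apply: h.
Qed.

(** Induction on the inspections. [C] is the cleaned set before the first one; inspecting [A] turns
    it into [D], and the move of the intruder shrinks [D] to its interior. The isoperimetric
    hypothesis keeps the size at most [m], so some vertex of [W] is never cleaned. *)
Lemma evasion (G : sgraph) (W : {set G}) m :
  (forall D : {set G}, D \subset W -> #|D| <= m + 3 -> #|interior W D| <= m) ->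
  m + 3 < #|W| ->
  forall s : seq {set G}, all (fun A : {set G} => #|A| <= 3) s ->
  forall C : {set G}, C \subset W -> #|C| <= m ->
  exists w : nat -> G, [/\ trajectory w, w 0 \in W :\: C &
    forall i, i < size s -> w i \notin nth set0 s i].
Proof.
move=> iso Wm; elim=> [|A s IH] /= As C CW Cm.
  have /card_gt0P[x xP] : 0 < #|W :\: C|.
    by have := cardsID C W; have := subset_leq_card (subsetIr W C); lia.
  by exists (fun=> x); split=> // i; left.
case/andP: As => A3 s3; pose D := C :|: (A :&: W).
have DW : D \subset W by rewrite subUset CW subsetIr.
have Dm : #|D| <= m + 3.
  have := cardsUI C (A :&: W); have := subset_leq_card (subsetIl A W).
  by rewrite /D; lia.
have IW : interior W D \subset W.
  by apply/subsetP => x /interiorP[xD _]; apply: (subsetP DW).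
have [w [tw w0 ws]] := IH s3 _ IW (iso _ DW Dm).
(* The walk is extended backwards: [w 0] is not interior, so it lies outside [D] itself or has a
   neighbour in [W] outside [D]. *)
have [z zP zw] : exists2 z, z \in W :\: D & w 0 = z \/ adj z (w 0).
  move: w0; rewrite inE => /andP[w0 w0W].
  case: (boolP (w 0 \in D)) => w0D; last by exists (w 0); [rewrite inE w0D|left].
  case: (pselect (exists2 z, z \in W :\: D & adj z (w 0))) => [[z ? ?]|no].
    by exists z => //; right.
  case/negP: w0; apply/interiorP; split=> // y yW wy; apply/negPn/negP => yD.
  by apply: no; exists y; rewrite 1?adj_sym // inE yD.
have zA : z \notin A.
  by case/setDP: zP => zW; apply: contra => zA; rewrite !inE zA zW orbT.
exists (fun i => if i is j.+1 then w j else z); split.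
- by case=> [|i]; [exact: zw | exact: tw].
- by case/setDP: zP => zW; rewrite !inE zW negb_or => /andP[-> _].
- by case=> [|i] //= /ws.
Qed.

(** * Blobs between two hubs, and sets with at most two boundary vertices *)

(** [S] spreads only from vertices of [B]: it may reach a hub without spreading from there. *)
Definition closed_on (G : sgraph) (B W S : {set G}) : Prop :=
  forall x y, x \in B -> x \in S -> y \in W -> adj x y -> y \in S.

(* linked: B is connected and touches both hubs. robust: deleting any y from B
   leaves no part of B cut off from both hubs. *)
Definition linked (G : sgraph) (h1 h2 : G) (B : {set G}) : Prop :=
  forall S : {set G}, closed_on B (h1 |: (h2 |: B)) S ->
    forall x, x \in B -> x \in S -> h1 |: (h2 |: B) \subset S.

Definition robust (G : sgraph) (h1 h2 : G) (B : {set G}) : Prop :=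
  forall (S : {set G}) y, closed_on (B :\ y) (h1 |: (h2 |: B)) S ->
    forall x, x \in B :\ y -> x \in S -> (h1 \in S) || (h2 \in S).

Lemma linked_adj (G : sgraph) (h1 h2 : G) (B : {set G}) x h :
  linked h1 h2 B -> x \in B -> h \notin B -> h \in [set h1; h2] ->
  exists2 y, y \in B & adj y h.
Proof.
move=> lB xB hB hh.
case: (pselect (exists2 y, y \in B & adj y h)) => // no.
(* If no vertex of [B] is adjacent to [h], the complement of [h] is closed, and linkedness would put
   [h] in it. *)
have /subsetP/(_ h) : h1 |: (h2 |: B) \subset ~: [set h].
  apply: (lB _ _ x xB); last by rewrite !inE; apply: contraNneq hB => <-.
  move=> y z yB _ _ yz; rewrite !inE; apply/eqP => e; apply: no.
  by exists y; rewrite // -e.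
by move: hh; rewrite !inE eqxx => /orP[]->; rewrite ?orbT => /(_ isT).
Qed.

Lemma card2_elim (T : finType) (F : {set T}) a b c :
  #|F| <= 2 -> a \in F -> b \in F -> a != b -> c \in F -> c = a \/ c = b.
Proof.
move=> F2 aF bF ab cF; case: (c =P a) => [|ca]; first by left.
case: (c =P b) => [|cb]; first by right.
have : c |: [set a; b] \subset F by rewrite !subUset !sub1set cF aF bF.
have cab : c \notin [set a; b] by rewrite !inE; apply/norP; split; apply/eqP.
by move/subset_leq_card; rewrite cardsU1 cab cards2 ab; lia.
Qed.

(* Three blobs and at most two boundary vertices: some blob, here X, has none. *)
Lemma small_boundary_aux (G : sgraph) (h1 h2 : G) (X Y Z W D : {set G}) m :
  h1 != h2 -> W = h1 |: (h2 |: (X :|: Y :|: Z)) ->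
  [disjoint Y & Z] ->
  (forall h, h \in [set h1; h2] -> [/\ h \notin X, h \notin Y & h \notin Z]) ->
  linked h1 h2 X -> linked h1 h2 Y -> linked h1 h2 Z -> robust h1 h2 Y ->
  X != set0 -> #|X| <= m -> #|Y| <= m -> #|Z| <= m ->
  D \subset W -> #|D :\: interior W D| <= 2 ->
  X :&: (D :\: interior W D) = set0 ->
  #|interior W D| <= m \/ #|W :\: D| <= m.
Proof.
move=> h12 WE dYZ hub lX lY lZ rY /set0Pn[x0 x0X] Xm Ym Zm DW.
set I := interior W D; set F := D :\: I => F2 XF.
have [h1X h1Y h1Z] := hub h1 (set21 _ _).
have [h2X h2Y h2Z] := hub h2 (set22 _ _).
have small (A B : {set G}) : {subset A <= B} -> #|B| <= m -> #|A| <= m.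
  by move=> /subsetP/subset_leq_card AB; apply: leq_trans.
have DI x : x \in D -> x \notin F -> x \in I by rewrite !inE => ->; rewrite andbT negbK.
have ID x : x \in I -> x \in D by case/interiorP.
have IF x : x \in I -> x \notin F by rewrite [x \in F]inE => ->.
have FD x : x \in F -> x \in D by case/setDP.
have Iadj x y : x \in I -> y \in W -> adj x y -> y \in D.
  by case/interiorP => _; apply.
have Wcase x : x \in W -> [\/ x \in [set h1; h2], x \in X, x \in Y | x \in Z].
  rewrite WE !inE -!orbA => /or4P[->|->||/orP[]]; rewrite ?orbT; by
    [constructor 1 | constructor 2 | constructor 3 | constructor 4].
have hW h : h \in [set h1; h2] -> h \in W.
  by rewrite WE !inE => /orP[]->; rewrite ?orbT.
have XW x : x \in X -> x \in W by rewrite WE !inE => ->; rewrite !orbT.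
have YW x : x \in Y -> x \in W by rewrite WE !inE => ->; rewrite !orbT.
have ZW x : x \in Z -> x \in W by rewrite WE !inE => ->; rewrite !orbT.
have EW (B : {set G}) : {subset B <= W} -> {subset h1 |: (h2 |: B) <= W}.
  move=> BW x; rewrite !inE => /or3P[/eqP->|/eqP->|/BW //]; apply: hW;
    by rewrite !inE eqxx ?orbT.
(* A blob without boundary vertices that meets [D] lies in [D] together with both hubs. *)
have full (B : {set G}) x : {subset B <= W} -> linked h1 h2 B ->
    (forall y, y \in B -> y \notin F) -> x \in B -> x \in D ->
    h1 |: (h2 |: B) \subset D.
  move=> BW lB BF xB xD; apply: (lB _ _ x) => // y z yB yD /(EW _ BW) zW.
  by apply: Iadj => //; apply: DI => //; apply: BF.
have hubD (B : {set G}) h : h1 |: (h2 |: B) \subset D -> h \in [set h1; h2] -> h \in D.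
  by move/subsetP => + hh; apply; move: hh; rewrite !inE => /orP[]->; rewrite ?orbT.
have blobD (B : {set G}) y : h1 |: (h2 |: B) \subset D -> y \in B -> y \in D.
  by move/subsetP => + yB; apply; rewrite !inE yB !orbT.
have touch (B : {set G}) x h : {subset B <= W} -> linked h1 h2 B -> x \in B ->
    h \notin B -> h \in [set h1; h2] -> (forall y, y \in B -> y \notin D) ->
    h \notin I.
  move=> BW lB xB hB hh BD; case: (linked_adj lB xB hB hh) => y yB yh.
  apply/negP => hI; case/negP: (BD y yB); apply: (Iadj h) => //; last by rewrite adj_sym.
  exact: BW.
(* If both hubs are in [D] and some blob misses [D], the hubs are boundary vertices, and they
   exhaust the boundary. *)
have hubF (B : {set G}) x : {subset B <= W} -> linked h1 h2 B -> x \in B ->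
    h1 \notin B -> h2 \notin B -> h1 \in D -> h2 \in D ->
    (forall y, y \in B -> y \notin D) ->
    forall f, f \in F -> f = h1 \/ f = h2.
  move=> BW lB xB h1B h2B h1D h2D BD f fF; apply: card2_elim h12 fF => //;
    rewrite in_setD ?h1D ?h2D andbT; by apply: touch BD => //; eauto; rewrite !inE eqxx ?orbT.
(* First case: [X] meets [D]. Then [X] and the hubs lie in [D], and the complement of [D] lies in
   [Y] and [Z]; it remains to treat the case where it meets both. *)
have [[x /andP[xX xD]]|XD] := pselect (exists x, (x \in X) && (x \in D)).
  have XsD := full X x XW lX _ xX xD.
  have {}XsD : h1 |: (h2 |: X) \subset D.
    apply: XsD => y yX; apply/negP => yF.
    by have : y \in X :&: F; [rewrite inE yX yF | rewrite XF inE].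
  have h1D := hubD _ _ XsD (set21 _ _); have h2D := hubD _ _ XsD (set22 _ _).
  have dirty y : y \in W -> y \notin D -> y \in Y \/ y \in Z.
    move=> /Wcase[/set2P[]->|yX|yY|yZ]; rewrite ?h1D ?h2D //; try by [left|right].
    by rewrite (blobD _ _ XsD yX).
  have [YD|/existsNP[y0 /not_implyP[y0Y /negP y0D]]] := pselect (forall y, y \in Y -> y \in D).
    right; apply: small Zm => y /setDP[yW yD]; case: (dirty y yW yD) => // /YD e.
    by rewrite e in yD.
  have [ZD|/existsNP[z0 /not_implyP[z0Z /negP z0D]]] := pselect (forall z, z \in Z -> z \in D).
    right; apply: small Ym => y /setDP[yW yD]; case: (dirty y yW yD) => // /ZD e.
    by rewrite e in yD.
  have alldirty (B : {set G}) b : {subset B <= W} -> linked h1 h2 B -> b \in B ->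
      b \notin D -> (forall y, y \in B -> y \notin F) -> forall y, y \in B -> y \notin D.
    move=> BW lB bB bD BF y yB; apply/negP => yD.
    by rewrite (blobD _ _ (full _ _ BW lB BF yB yD) bB) in bD.
  have onlyX : (forall f, f \in F -> f = h1 \/ f = h2) -> #|I| <= m.
    move=> Fh; apply: small Xm => z zI.
    have noF (B : {set G}) : h1 \notin B -> h2 \notin B -> forall y, y \in B -> y \notin F.
      move=> h1B h2B y yB; apply/negP => /Fh[] e; by rewrite -e yB in h1B h2B.
    have YnD := alldirty _ _ YW lY y0Y y0D (noF _ h1Y h2Y).
    have ZnD := alldirty _ _ ZW lZ z0Z z0D (noF _ h1Z h2Z).
    have t1 : h1 \notin I by apply: touch YnD => //; [exact: y0Y | rewrite set21].
    have t2 : h2 \notin I by apply: touch YnD => //; [exact: y0Y | rewrite set22].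
    have zD := ID _ zI.
    case: (Wcase _ (subsetP DW _ zD)) => [/set2P[]e|//|/YnD|/ZnD]; rewrite ?zD //.
      by rewrite -e zI in t1.
    by rewrite -e zI in t2.
  have [[f /andP[fY fF]]|YF] := pselect (exists f, (f \in Y) && (f \in F)); last first.
    left; apply: onlyX; apply: (hubF Y y0) => //; apply: (alldirty Y y0) => //.
    by move=> y yY; apply/negP => yF; apply: YF; exists y; rewrite yY.
  have [[g /andP[gZ gF]]|ZF] := pselect (exists f, (f \in Z) && (f \in F)); last first.
    left; apply: onlyX; apply: (hubF Z z0) => //; apply: (alldirty Z z0) => //.
    by move=> y yZ; apply/negP => yF; apply: ZF; exists y; rewrite yZ.
  have fg : f != g by apply: contraTneq gZ => <-; rewrite (disjointFr dYZ fY).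
  have Fonly c : c \in F -> c = f \/ c = g by apply: card2_elim.
  have hF h : h \in [set h1; h2] -> h \notin F.
    case/hub => _ hY hZ; apply/negP => /Fonly[] e; by rewrite e ?fY ?gZ in hY hZ.
  have gE : g \notin h1 |: (h2 |: Y).
    rewrite !in_setU1 (disjointFl dYZ gZ) orbF negb_or.
    by apply/andP; split; [apply: contraNneq h1Z => <- | apply: contraNneq h2Z => <-].
  (* The only boundary vertex in [Y] is [f], so the complement of [D] spreads through [Y] minus [f].
     By robustness it gets from [y0] to a hub, but both hubs are in [D] and differ from [f]. *)
  have /orP[] : (h1 \in f |: ~: D) || (h2 \in f |: ~: D).
    apply: (rY _ f _ y0).
    - move=> a b /setD1P[af aY] aS bE ab; rewrite in_setU1; case: eqP => //= bf.
      rewrite in_setC; move: aS; rewrite in_setU1 (negPf af) in_setC /= => aD.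
      apply/negP => bD; have bF : b \notin F.
        by apply/negP => /Fonly[//|e]; rewrite e (negPf gE) in bE.
      by case/negP: aD; apply: (Iadj b (a)); rewrite 1?adj_sym ?DI ?YW.
    - by rewrite in_setD1 y0Y andbT; apply: contraNneq y0D => ->; apply: FD.
    - by rewrite !inE y0D orbT.
  - rewrite !inE h1D orbF => /eqP e; by rewrite e fY in h1Y.
  - rewrite !inE h2D orbF => /eqP e; by rewrite e fY in h2Y.
(* Second case, dual to the first: [X] misses [D], so no hub is interior and the interior lies in
   [Y] and [Z]. *)
have {}XD x : x \in X -> x \notin D.
  by move=> xX; apply/negP => xD; apply: XD; exists x; rewrite xX.
have hI h : h \in [set h1; h2] -> h \notin I.
  by move=> hh; have [hX _ _] := hub _ hh; apply: touch XD => //; eauto.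
have clean x : x \in I -> x \in Y \/ x \in Z.
  move=> xI; have xD := ID _ xI.
  case: (Wcase _ (subsetP DW _ xD)) => [/hI|/XD| |]; rewrite ?xI ?xD //; by [left|right].
have [YI|/existsNP[y0 /not_implyP[y0Y /negP]]] := pselect (forall y, y \in Y -> y \notin I).
  left; apply: small Zm => y yI; case: (clean _ yI) => // /YI; by rewrite yI.
have [ZI|/existsNP[z0 /not_implyP[z0Z /negP]]] := pselect (forall y, y \in Z -> y \notin I).
  left; apply: small Ym => y yI; case: (clean _ yI) => // /ZI; by rewrite yI.
rewrite !negbK => z0I y0I.
have onlyX : h1 \in D -> h2 \in D -> #|W :\: D| <= m.
  move=> h1D h2D.
  have Fh f : f \in F -> f = h1 \/ f = h2.
    by apply: (hubF X x0).
  have noF (B : {set G}) : h1 \notin B -> h2 \notin B -> forall y, y \in B -> y \notin F.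
    move=> h1B h2B y yB; apply/negP => /Fh[] e; by rewrite -e yB in h1B h2B.
  have YD := full _ _ YW lY (noF _ h1Y h2Y) y0Y (ID _ y0I).
  have ZD := full _ _ ZW lZ (noF _ h1Z h2Z) z0Z (ID _ z0I).
  apply: small Xm => x /setDP[/Wcase[/set2P[]->||xY|xZ]]; rewrite ?h1D ?h2D //.
    by rewrite (blobD _ _ YD xY).
  by rewrite (blobD _ _ ZD xZ).
have [[f /andP[fY fF]]|YF] := pselect (exists f, (f \in Y) && (f \in F)); last first.
  have YD : h1 |: (h2 |: Y) \subset D.
    apply: (full Y y0) => //; last exact: ID.
    by move=> y yY; apply/negP => yF; apply: YF; exists y; rewrite yY.
  by right; apply: onlyX; apply: hubD YD _; rewrite !inE eqxx ?orbT.
have [[g /andP[gZ gF]]|ZF] := pselect (exists f, (f \in Z) && (f \in F)); last first.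
  have ZD : h1 |: (h2 |: Z) \subset D.
    apply: (full Z z0) => //; last exact: ID.
    by move=> y yZ; apply/negP => yF; apply: ZF; exists y; rewrite yZ.
  by right; apply: onlyX; apply: hubD ZD _; rewrite !inE eqxx ?orbT.
have fg : f != g by apply: contraTneq gZ => <-; rewrite (disjointFr dYZ fY).
have Fonly c : c \in F -> c = f \/ c = g by apply: card2_elim.
have hD h : h \in [set h1; h2] -> h \notin D.
  move=> hh; have [_ hY hZ] := hub _ hh; apply/negP => hD.
  have /Fonly[e|e] : h \in F by rewrite in_setD hD andbT; apply: hI.
    by rewrite e fY in hY.
  by rewrite e gZ in hZ.
(* Robustness now carries membership in [D] from [y0] to a hub, while neither hub is in [D]. *)
have /orP[] : (h1 \in D) || (h2 \in D).
  apply: (rY D f _ y0); last exact: ID.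
    move=> a b; rewrite in_setD1 => /andP[af aY] aD /(EW _ YW) bW.
    apply: Iadj bW; apply: DI => //; apply/negP => /Fonly[e|e].
      by rewrite e eqxx in af.
    by rewrite e (disjointFl dYZ gZ) in aY.
  rewrite in_setD1 y0Y andbT; apply: contraTneq fF => <-; exact: IF.
- by rewrite (negPf (hD h1 (set21 _ _))).
- by rewrite (negPf (hD h2 (set22 _ _))).
Qed.

(** Two boundary vertices cannot meet three disjoint blobs, so some blob is free of them. Whichever
    it is, [X] or [Y] is a robust blob among the other two. *)
Lemma small_boundary (G : sgraph) (h1 h2 : G) (X Y Z W D : {set G}) m :
  h1 != h2 -> W = h1 |: (h2 |: (X :|: Y :|: Z)) ->
  [disjoint X & Y] -> [disjoint X & Z] -> [disjoint Y & Z] ->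
  (forall h, h \in [set h1; h2] -> [/\ h \notin X, h \notin Y & h \notin Z]) ->
  linked h1 h2 X -> linked h1 h2 Y -> linked h1 h2 Z ->
  robust h1 h2 X -> robust h1 h2 Y ->
  X != set0 -> Y != set0 -> Z != set0 -> #|X| <= m -> #|Y| <= m -> #|Z| <= m ->
  D \subset W -> #|D :\: interior W D| <= 2 ->
  #|interior W D| <= m \/ #|W :\: D| <= m.
Proof.
move=> h12 WE dXY dXZ dYZ hub lX lY lZ rX rY X0 Y0 Z0 Xm Ym Zm DW F2.
have hub1 h : h \in [set h1; h2] -> [/\ h \notin Y, h \notin X & h \notin Z].
  by case/hub.
have hub2 h : h \in [set h1; h2] -> [/\ h \notin Z, h \notin X & h \notin Y].
  by case/hub.
case: (set_0Vmem (X :&: (D :\: interior W D))) => [XF|[x /setIP[xX xF]]].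
  exact: small_boundary_aux h12 WE dYZ hub lX lY lZ rY X0 Xm Ym Zm DW F2 XF.
case: (set_0Vmem (Y :&: (D :\: interior W D))) => [YF|[y /setIP[yY yF]]].
  apply: small_boundary_aux h12 _ dXZ hub1 lY lX lZ rX Y0 Ym Xm Zm DW F2 YF.
  by rewrite WE (setUC Y).
case: (set_0Vmem (Z :&: (D :\: interior W D))) => [ZF|[z /setIP[zZ zF]]].
  apply: small_boundary_aux h12 _ dXY hub2 lZ lX lY rX Z0 Zm Xm Ym DW F2 ZF.
  by rewrite WE -(setUA Z) (setUC Z).
have xy : x != y by apply: contraTneq yY => <-; rewrite (disjointFr dXY xX).
case: (card2_elim F2 xF yF xy zF) => e; rewrite e in zZ.
  by rewrite (disjointFr dXZ xX) in zZ.
by rewrite (disjointFr dYZ yY) in zZ.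
Qed.

(** If [D] has at most [m + 3] vertices and more than [m] interior ones, its boundary has at most
    two. Its complement then has at most [m] vertices, so [W] has at most [2m + 3]; but the blobs
    and the two hubs make at least [2m + 4]. *)
Lemma theta_evasion (G : sgraph) (h1 h2 : G) (X Y Z : {set G}) m :
  h1 != h2 ->
  [disjoint X & Y] -> [disjoint X & Z] -> [disjoint Y & Z] ->
  (forall h, h \in [set h1; h2] -> [/\ h \notin X, h \notin Y & h \notin Z]) ->
  linked h1 h2 X -> linked h1 h2 Y -> linked h1 h2 Z ->
  robust h1 h2 X -> robust h1 h2 Y ->
  0 < #|X| <= m -> 0 < #|Y| <= m -> 0 < #|Z| <= m ->
  m.*2 + 2 <= #|X| + #|Y| + #|Z| ->
  forall s : seq {set G}, all (fun A : {set G} => #|A| <= 3) s -> ~ captures s.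
Proof.
move=> h12 dXY dXZ dYZ hub lX lY lZ rX rY /andP[X0 Xm] /andP[Y0 Ym] /andP[Z0 Zm] big s s3 cs.
rewrite !card_gt0 in X0 Y0 Z0.
pose W := h1 |: (h2 |: (X :|: Y :|: Z)).
have cW : #|W| = #|X| + #|Y| + #|Z| + 2.
  have [h1X h1Y h1Z] := hub h1 (set21 _ _).
  have [h2X h2Y h2Z] := hub h2 (set22 _ _).
  rewrite /W !cardsU1 !inE (negPf h12) (negPf h1X) (negPf h1Y) (negPf h1Z).
  rewrite (negPf h2X) (negPf h2Y) (negPf h2Z) /=.
  have -> : #|X :|: Y :|: Z| = #|X| + #|Y| + #|Z|.
    have XYZ : (X :|: Y) :&: Z = set0 by rewrite setIUl !disjoint_setI0 // setU0.
    by rewrite cardsU XYZ cardsU (disjoint_setI0 dXY) cards0 !subn0.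
  by rewrite !add1n addn2.
have [|||w [tw _ ws]] := @evasion G W m _ _ s s3 set0 (sub0set _).
- move=> D DW Dm.
  have /setIidPr ID : interior W D \subset D by apply/subsetP => x /interiorP[].
  have cD := cardsID (interior W D) D; rewrite ID in cD.
  have cWD := cardsID D W; rewrite (setIidPr DW) in cWD.
  case: (leqP #|D :\: interior W D| 2) => F2; last first.
    by move: cD Dm F2; clear; lia.
  have [//|WDm] := small_boundary h12 (erefl W) dXY dXZ dYZ hub lX lY lZ rX rY
                     X0 Y0 Z0 Xm Ym Zm DW F2.
  by move: cWD cW big Dm WDm; clear; lia.
- by rewrite cW; move: big; clear; lia.
- by rewrite cards0.
- by have [i /ws/negP] := cs w tw.
Qed.

(** * Paths, possibly with a pendant path, as blobs *)

Lemma path_rcons_rev (G : sgraph) (x y : G) s :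
  path (@adj G) x (rcons s y) -> path (@adj G) y (rcons (rev s) x).
Proof.
move=> p; rewrite -rev_cons -(belast_rcons x s y) -[X in path _ X](last_rcons x s y).
by rewrite rev_path; apply: sub_path p => a b; rewrite adj_sym.
Qed.

(** [belast] leaves out the endpoint, which may be a hub: it is reached but need not spread. *)
Lemma path_closed (G : sgraph) (W S : {set G}) x s :
  path (@adj G) x s -> {subset s <= W} -> x \in S ->
  closed_on [set y in belast x s] W S -> {subset s <= S}.
Proof.
elim: s x => [|y s IH] x //= /andP[xy ys] sW xS clo.
have yS : y \in S by apply: (clo x y); rewrite ?inE ?eqxx //; apply: sW; rewrite inE eqxx.
move=> z; rewrite inE => /orP[/eqP-> //|]; apply: (IH y) => //.
  by move=> t ts; apply: sW; rewrite inE ts orbT.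
by move=> a b; rewrite inE => ab; apply: clo; rewrite inE /= inE ab orbT.
Qed.

Lemma path_linked (G : sgraph) (h1 h2 : G) s :
  path (@adj G) h1 (rcons s h2) -> linked h1 h2 [set x in s].
Proof.
move=> p S clo z; rewrite inE => zs zS.
case/splitPr: zs p clo => s1 s2; rewrite rcons_cat cat_path /= => /and3P[p1 p2 p3] clo.
have fwd : {subset rcons s2 h2 <= S}.
  apply: (path_closed (W := h1 |: (h2 |: [set x in s1 ++ z :: s2])) p3) => //.
    by move=> x; rewrite mem_rcons !inE mem_cat inE => /orP[]->; rewrite ?orbT.
  move=> x y; rewrite inE belast_rcons => xs; apply: clo; rewrite inE mem_cat.
  by rewrite xs orbT.
have bwd : {subset rcons (rev s1) h1 <= S}.
  have /path_rcons_rev : path (@adj G) h1 (rcons s1 z) by rewrite rcons_path p1.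
  move=> q; apply: (path_closed (W := h1 |: (h2 |: [set x in s1 ++ z :: s2])) q) => //.
    by move=> x; rewrite mem_rcons !inE mem_cat mem_rev => /orP[]->; rewrite ?orbT.
  move=> x y; rewrite inE belast_rcons inE mem_rev => xs; apply: clo.
  by rewrite inE mem_cat inE; case/orP: xs => ->; rewrite ?orbT.
apply/subsetP => x; rewrite !inE mem_cat inE.
case/or3P => [/eqP->|/eqP->|/or3P[xs|/eqP->//|xs]].
- by apply: bwd; rewrite mem_rcons inE eqxx.
- by apply: fwd; rewrite mem_rcons inE eqxx.
- by apply: bwd; rewrite mem_rcons inE mem_rev xs orbT.
- by apply: fwd; rewrite mem_rcons inE xs orbT.
Qed.

(** The path has no repetition, so deleting [y] leaves intact one of the two stretches from [z] to a
    hub. *)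
Lemma path_robust (G : sgraph) (h1 h2 : G) s :
  uniq s -> path (@adj G) h1 (rcons s h2) -> robust h1 h2 [set x in s].
Proof.
move=> us p S y clo z /setD1P[zy]; rewrite inE => zs zS.
case/splitPr: zs us p clo => s1 s2; rewrite rcons_cat cat_path cat_uniq /=.
move=> /and3P[_ dis _] /and3P[p1 p2 p3] clo.
have [ys2|ys2] := boolP (y \in s2).
  have ys1 : y \notin s1 by case/norP: dis => _ /hasPn/(_ _ ys2).
  have /path_rcons_rev q : path (@adj G) h1 (rcons s1 z) by rewrite rcons_path p1.
  apply/orP; left; apply: (path_closed (W := h1 |: (h2 |: [set x in s1 ++ z :: s2])) q) => //.
  - by move=> x; rewrite mem_rcons !inE mem_cat mem_rev => /orP[]->; rewrite ?orbT.
  - move=> a b; rewrite inE belast_rcons inE mem_rev => xs; apply: clo.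
    rewrite !inE mem_cat inE; case/orP: xs => [/eqP->|xs]; first by rewrite zy eqxx orbT.
    by rewrite xs /= andbT; apply: contraNneq ys1 => <-.
  - by rewrite mem_rcons inE eqxx.
apply/orP; right; apply: (path_closed (W := h1 |: (h2 |: [set x in s1 ++ z :: s2])) p3) => //.
- by move=> x; rewrite mem_rcons !inE mem_cat inE => /orP[]->; rewrite ?orbT.
- move=> a b; rewrite inE belast_rcons inE => xs; apply: clo.
  rewrite !inE mem_cat inE; case/orP: xs => [/eqP->|xs]; first by rewrite zy eqxx orbT.
  by rewrite xs !orbT andbT; apply: contraNneq ys2 => <-.
- by rewrite mem_rcons inE eqxx.
Qed.

(** From a vertex of the pendant path [t], walk back to its foot [u]; then spread along [s] to both
    hubs, and from [u] along all of [t]. *)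
Lemma path_pendant_linked (G : sgraph) (h1 h2 u : G) s t :
  path (@adj G) h1 (rcons s h2) -> u \in s -> path (@adj G) u t ->
  linked h1 h2 [set x in s ++ t].
Proof.
move=> p us q S clo z zst zS.
pose W := h1 |: (h2 |: [set x in s ++ t]).
have tW : {subset t <= W} by move=> x xt; rewrite !inE mem_cat xt !orbT.
have [a as_ aS] : exists2 a, a \in s & a \in S.
  move: zst; rewrite inE mem_cat => /orP[zs|zt]; first by exists z.
  exists u => //; have [t1 [t2 te]] : exists t1 t2, t = t1 ++ z :: t2.
    by case/splitPr: zt => t1 t2; exists t1, t2.
  move: q; rewrite te cat_path /= => /and3P[q1 q2 _].
  have /path_rcons_rev q : path (@adj G) u (rcons t1 z) by rewrite rcons_path q1.
  apply: (path_closed (W := W) q) => //; last by rewrite mem_rcons inE eqxx.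
    move=> x; rewrite mem_rcons inE mem_rev => /orP[/eqP->|xt].
      by rewrite !inE mem_cat us !orbT.
    by apply: tW; rewrite te mem_cat xt.
  move=> x y; rewrite inE belast_rcons inE mem_rev => xs; apply: clo.
  by rewrite inE te !mem_cat inE; case/orP: xs => ->; rewrite ?orbT.
have sS : h1 |: (h2 |: [set x in s]) \subset S.
  apply: (path_linked p _ _ aS); last by rewrite inE.
  move=> x y; rewrite inE => xs xS yE; apply: clo; rewrite // ?inE ?mem_cat ?xs //.
  by move: yE; rewrite !inE => /or3P[]->; rewrite ?orbT.
have tS : {subset t <= S}.
  apply: (path_closed (W := W) q tW).
    by apply: (subsetP sS); rewrite !inE us !orbT.
  move=> x y; rewrite inE => /mem_belast; rewrite inE => xt; apply: clo.
  by rewrite inE mem_cat; case/orP: xt => [/eqP->|->]; rewrite ?us ?orbT.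
apply/subsetP => x xE; case: (boolP (x \in t)) => [/tS //|xt].
by apply: (subsetP sS); move: xE; rewrite !inE mem_cat (negPf xt) orbF.
Qed.

(** * Theta graphs in a topological K4 and the balancing of their blobs *)

(* A topological copy of K4: branch vertices b i, joined by internally
   disjoint paths with inner vertices p i j. *)
Definition k4_model (G : sgraph) (b : 'I_4 -> G) (p : 'I_4 -> 'I_4 -> seq G) : Prop :=
  [/\ injective b,
      forall i j, p j i = rev (p i j),
      forall i j, i != j -> path (@adj G) (b i) (rcons (p i j) (b j)) /\ uniq (p i j),
      forall i j k, i != j -> b k \notin p i j &
      forall i j k l x, i != j -> k != l -> x \in p i j -> x \in p k l ->
        (k = i /\ l = j) \/ (k = j /\ l = i)].

(** The hubs are [b k] and [b l]; the blobs are the direct path, the path through [b i], and the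
    path through [b j] with the first [q] inner vertices of the edge from [b j] to [b i] hanging
    from it. The vertices [b i] and [b j] explain the strict inequalities and supply the slack of
    two. *)
Lemma k4_model_theta_evasion (G : sgraph) b (p : 'I_4 -> 'I_4 -> seq G) i j k l q m :
  k4_model b p -> uniq [:: i; j; k; l] ->
  q <= size (p i j) ->
  0 < size (p k l) <= m ->
  size (p k i) + size (p i l) < m ->
  size (p k j) + size (p j l) + q < m ->
  m.*2 <= size (p k l) + size (p k i) + size (p i l) + size (p k j) + size (p j l) + q ->
  forall s : seq {set G}, all (fun A : {set G} => #|A| <= 3) s -> ~ captures s.
Proof.
case=> binj prev pp bp pdis.
rewrite /= !inE !negb_or andbT => /and3P[/and3P[ij ik il] /andP[jk jl] kl] qe Xm Ym Zm big.
have [ji ki li] : [/\ j != i, k != i & l != i] by split; rewrite eq_sym.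
have [kj lj lk] : [/\ k != j, l != j & l != k] by split; rewrite eq_sym.
pose X := p k l; pose Y := p k i ++ b i :: p i l.
pose s := p k j ++ b j :: p j l; pose t := take q (p j i).
have sji : size (p j i) = size (p i j) by rewrite prev size_rev.
have st : size t = q by rewrite size_takel ?sji.
have join i' j' k' : k' != i' -> j' != i' ->
    path (@adj G) (b k') (rcons (p k' i' ++ b i' :: p i' j') (b j')).
  move=> ki' ji'; rewrite eq_sym in ji'.
  have [p1 _] := pp _ _ ki'; have [p2 _] := pp _ _ ji'.
  by rewrite rcons_cat rcons_cons -cat_rcons cat_path p1 last_rcons p2.
have nin i' j' k' l' x : i' != j' -> k' != l' -> x \in p i' j' ->
    ~~ ((k' == i') && (l' == j')) -> ~~ ((k' == j') && (l' == i')) -> x \notin p k' l'.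
  move=> n1 n2 x1 n3 n4; apply/negP => x2.
  case: (pdis _ _ _ _ _ n1 n2 x1 x2) => -[e1 e2]; first by rewrite e1 e2 !eqxx in n3.
  by rewrite e1 e2 !eqxx in n4.
have joinU i' j' k' : k' != i' -> i' != j' -> k' != j' -> uniq (p k' i' ++ b i' :: p i' j').
  move=> ki' ij' kj'; have [_ u1] := pp _ _ ki'; have [_ u2] := pp _ _ ij'.
  rewrite cat_uniq u1 /= u2 andbT bp // andbT negb_or bp //=.
  apply/hasPn => x x2; apply: (nin i' j') => //.
    by rewrite (negPf ki').
  by rewrite (negPf kj').
have tp x : x \in t -> x \in p j i by move/mem_take.
have ut : uniq t by have [_ u] := pp _ _ ji; apply: take_uniq.
have uZ : uniq (s ++ t).
  rewrite cat_uniq ut joinU //= andbT.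
  apply/hasPn => x /tp xt; rewrite mem_cat inE !negb_or.
  apply/and3P; split.
  - by apply: (nin j i); rewrite // ?(negPf kj) ?(negPf ki) ?andbF.
  - by apply: contraTneq xt => ->; rewrite bp.
  - by apply: (nin j i); rewrite // ?(negPf li) ?(negPf lj) ?andbF.
have uY : uniq Y by rewrite joinU.
have [pX uX] := pp _ _ kl.
have YE x : x \in Y -> [\/ x \in p k i, x = b i | x \in p i l].
  rewrite mem_cat inE => /or3P[?|/eqP?|?];
    by [constructor 1 | constructor 2 | constructor 3].
have ZE x : x \in s ++ t -> [\/ x \in p k j, x = b j, x \in p j l | x \in p j i].
  rewrite mem_cat mem_cat inE -!orbA => /or4P[?|/eqP?|?|/tp?];
    by [constructor 1 | constructor 2 | constructor 3 | constructor 4].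
have bne x y : x != y -> b x != b y by apply: contraNneq => /binj ->.
have ne := (negPf ij, negPf ik, negPf il, negPf jk, negPf jl, negPf kl,
            negPf ji, negPf ki, negPf li, negPf kj, negPf lj, negPf lk).
have cd (r : seq G) : uniq r -> #|[set x in r]| = size r.
  by move=> ?; rewrite cardsE; apply/card_uniqP.
have djs (r1 r2 : seq G) : (forall x, x \in r1 -> x \notin r2) ->
    [disjoint [set x in r1] & [set x in r2]].
  move=> h; rewrite -setI_eq0; apply/eqP/setP => x; rewrite !inE.
  by case: (boolP (x \in r1)) => //= /h/negPf.
apply: (@theta_evasion G (b k) (b l) [set x in X] [set x in Y] [set x in s ++ t] m).
- exact: bne.
- apply: djs => x xX; apply/negP => /YE[]; first by apply/negP/(nin k l); rewrite // ?ne ?andbF.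
    by move=> e; move: xX; rewrite /X e; apply/negP/bp.
  by apply/negP/(nin k l); rewrite // ?ne ?andbF.
- apply: djs => x xX; apply/negP => /ZE[].
  + by apply/negP/(nin k l); rewrite // ?ne ?andbF.
  + by move=> e; move: xX; rewrite /X e; apply/negP/bp.
  + by apply/negP/(nin k l); rewrite // ?ne ?andbF.
  + by apply/negP/(nin k l); rewrite // ?ne ?andbF.
- apply: djs => x /YE xY; apply/negP => /ZE xZ; move: xY.
  case: xZ => [xZ|->|xZ|xZ] [xY|e|xY]; try by
    [ move: xZ; apply/negP; apply: (nin _ _ _ _ _ _ _ xY); rewrite // ?ne ?andbF
    | move: xZ; rewrite e; apply/negP/bp
    | move: xY; apply/negP/bp
    | move/eqP: e; apply/negP/bne].
- have hub h : h != i -> h != j -> [/\ b h \notin X, b h \notin Y & b h \notin s ++ t].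
    move=> hi hj; split; first exact: bp.
      by rewrite mem_cat inE !negb_or !bp //= bne.
    rewrite !mem_cat inE !negb_or !bp //= bne //=.
    by apply/negP => /tp; apply/negP/bp.
  by move=> h /set2P[]->; rewrite !inE; apply: hub.
- exact: path_linked.
- by apply: path_linked; apply: join.
- apply: (path_pendant_linked (u := b j)); first exact: join.
    by rewrite mem_cat inE eqxx orbT.
  have [pt _] := pp _ _ ji; move: pt; rewrite -{1}(cat_take_drop q (p j i)) rcons_cat cat_path.
  by case/andP.
- exact: path_robust.
- by apply: path_robust => //; apply: join.
- by rewrite cd.
- by rewrite cd // size_cat /=; move: Ym; clear; lia.
- by rewrite cd // !size_cat /= st; move: Zm; clear; lia.
- by rewrite !cd // !size_cat /= st /X; move: big; clear; lia.
Qed.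

(* e and f are opposite edges, e is longest, a1, a2 and c1, c2 are the other edges
   at the two ends of e. Cutting e gives hubs at the ends of f and leaves a
   pendant path of length q; if a1 + a2 is too long for that, cut f instead. *)
Lemma theta_lengths e f a1 a2 c1 c2 :
  1 < e -> 1 < f -> 1 < a1 -> 1 < a2 -> 1 < c1 -> 1 < c2 ->
  f <= e -> a1 <= e -> a2 <= e -> c1 + c2 <= a1 + a2 ->
  (exists q m, [/\ q <= e, f <= m, a1 + a2 < m, c1 + c2 + q < m &
     m.*2 <= f + a1 + a2 + c1 + c2 + q]) \/
  (exists m, [/\ e <= m, a1 + c1 < m, a2 + c2 < m &
     m.*2 <= e + a1 + c1 + a2 + c2]).
Proof.
move=> e2 f2 a12 a22 c12 c22 fe a1e a2e ca.
pose M := maxn (a1 + a2).+1 f.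
(* This [q] brings the third blob to size exactly [M], the larger of the two other blobs. *)
have [le|lt] := leqP (M - (c1 + c2).+1) e.
  left; exists (M - (c1 + c2).+1), M; rewrite /M in le *; split; lia.
(* Since [f <= e], here [M] is [(a1 + a2).+1], and even the whole of [e] is too short to reach
   it. *)
have [le|lt'] := leqP (a1 + a2 + 2) (f + c1 + c2 + e).
  by left; exists e, (a1 + a2).+1; rewrite /M in lt; split; lia.
(* As [a1] and [a2] are at most [e] and [f] is at least 2, each of [a1] and [a2] now exceeds
   [c1 + c2], which balances the theta graph with hubs at the ends of [e]. *)
right; exists (maxn e (maxn (a1 + c1).+1 (a2 + c2).+1)); split; lia.
Qed.

Lemma k4_model_evasion (G : sgraph) b (p : 'I_4 -> 'I_4 -> seq G) :
  k4_model b p -> (forall i j, i != j -> 1 < size (p i j)) ->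
  forall s : seq {set G}, all (fun A : {set G} => #|A| <= 3) s -> ~ captures s.
Proof.
move=> Mp p2; have [_ prev _ _ _] := Mp.
have sC i j : size (p j i) = size (p i j) by rewrite prev size_rev.
have main i j k l : uniq [:: i; j; k; l] ->
    (forall x y, x != y -> size (p x y) <= size (p i j)) ->
    size (p k j) + size (p j l) <= size (p k i) + size (p i l) ->
    forall s : seq {set G}, all (fun A : {set G} => #|A| <= 3) s -> ~ captures s.
  move=> u4 mx le; have u4' : uniq [:: k; l; i; j] by rewrite (uniq_catC [:: k; l] [:: i; j]).
  move: (u4); rewrite /= !inE !negb_or andbT => /and3P[/and3P[ij ik il] /andP[jk jl] kl].
  have [ki kj] : k != i /\ k != j by rewrite !(eq_sym k).
  have [] := theta_lengths (p2 _ _ ij) (p2 _ _ kl) (p2 _ _ ki) (p2 _ _ il)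
               (p2 _ _ kj) (p2 _ _ jl) (mx _ _ kl) (mx _ _ ki) (mx _ _ il) le.
    move=> [q [m [qe fm am cm big]]].
    apply: (k4_model_theta_evasion Mp u4 qe _ am cm); last by move: big; clear; lia.
    by rewrite fm andbT; apply: ltnW; apply: p2.
  move=> [m [em am cm big]].
  have eq1 := sC k i; have eq2 := sC j l.
  apply: (k4_model_theta_evasion (q := 0) (m := m) Mp u4') => //.
  - by rewrite em andbT; apply: ltnW; apply: p2.
  - by rewrite eq1; move: am; clear; lia.
  - by rewrite addn0 eq2; move: cm; clear; lia.
  - by rewrite addn0 eq1 eq2; move: big; clear; lia.
have [i [j [ij mx]]] : exists i j, i != j /\
    forall x y, x != y -> size (p x y) <= size (p i j).
  case: (@arg_maxnP _ (ord0, ord_max) (fun ij : 'I_4 * 'I_4 => ij.1 != ij.2)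
           (fun ij => size (p ij.1 ij.2))) => // -[i j] /= ij mx.
  by exists i, j; split=> // x y xy; apply: (mx (x, y)).
have [k [l u4]] : exists k l, uniq [:: i; j; k; l].
  have : #|~: [set i; j]| == 2 by have := cardsC [set i; j]; rewrite cards2 ij card_ord; lia.
  case/cards2P => k [l [kl /setP klE]]; exists k, l.
  have := klE k; have := klE l; rewrite /= !inE !eqxx orbT /= => /norP[li lj] /norP[ki kj].
  by rewrite !negb_or ij kl !(eq_sym _ k) !(eq_sym _ l) ki li kj lj.
(* Exchanging [i] and [j] lets the longer pair of side edges be at [i]. *)
have [le|le] := leqP (size (p k j) + size (p j l)) (size (p k i) + size (p i l)).
  exact: (main i j k l).
apply: (main j i k l); last exact: ltnW.
  by move: u4; rewrite /= !inE (eq_sym j i); case: (i == j) => //=; rewrite andbCA.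
by move=> x y xy; rewrite (sC i j); apply: mx.
Qed.

(** * Topological copies of K4 under subdivision *)

Lemma k4_model_complete :
  k4_model (G := complete_graph 4) id (fun _ _ => [::]).
Proof. by split=> // i j ij; split=> //=; rewrite /complete_rel ij. Qed.

Lemma subdivision_trans (G H K : sgraph) :
  subdivision G H -> subdivision H K -> subdivision G K.
Proof.
move=> GH; elim=> // K' u v _ IH uv; exact: Subdivision_edge.
Qed.

(* The inner vertices, in the subdivision of the edge uv, of the path from x
   to y with inner vertices s. *)
Fixpoint subdivide_path (G : sgraph) (u v x : G) (s : seq G) (y : G) : seq (option G) :=
  match s with
  | [::] => if [set x; y] == [set u; v] then [:: None] else [::]
  | z :: s' =>
    (if [set x; z] == [set u; v] then [:: None] else [::]) ++
      Some z :: subdivide_path u v z s' y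
  end.

Lemma subdivide_path_cat (G : sgraph) (u v : G) x s z t y :
  subdivide_path u v x (s ++ z :: t) y =
  subdivide_path u v x s z ++ Some z :: subdivide_path u v z t y.
Proof. by elim: s x => [|w s IH] x //=; rewrite IH -catA. Qed.

Lemma subdivide_path_rev (G : sgraph) (u v : G) x s y :
  subdivide_path u v y (rev s) x = rev (subdivide_path u v x s y).
Proof.
elim: s x => [|z s IH] x /=; first by rewrite setUC; case: ifP.
rewrite rev_cons -cats1 subdivide_path_cat IH /= rev_cat rev_cons cat_rcons setUC.
by case: ifP.
Qed.

Lemma mem_subdivide_path (G : sgraph) (u v : G) x s y z :
  (Some z \in subdivide_path u v x s y) = (z \in s).
Proof.
elim: s x => [|w s IH] x /=; first by case: ifP.
by rewrite mem_cat !inE IH; case: ifP.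
Qed.

Lemma set2_mem (T : finType) (u v x y : T) :
  [set x; y] = [set u; v] ->
  [/\ x \in [set u; v], y \in [set u; v], u \in [set x; y] & v \in [set x; y]].
Proof.
by move=> e; split;
  [rewrite -e set21 | rewrite -e set22 | rewrite e set21 | rewrite e set22].
Qed.

Lemma None_subdivide_path (G : sgraph) (u v : G) x s y :
  None \in subdivide_path u v x s y ->
  u \in x :: rcons s y /\ v \in x :: rcons s y.
Proof.
elim: s x => [|z s IH] x /=.
  case: eqP => // /set2_mem[_ _ + +] _; by rewrite !inE.
rewrite mem_cat inE /=; case: eqP => [/set2_mem[_ _ ue ve] _|_ /= /IH[ue ve]].
  by move: ue ve; rewrite !inE => /orP[]-> /orP[]->; rewrite ?orbT.
by rewrite !(in_cons x) ue ve !orbT.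
Qed.

Lemma subdivide_path_uniq (G : sgraph) (u v : G) x s y :
  uniq (x :: rcons s y) -> uniq (subdivide_path u v x s y).
Proof.
elim: s x => [|z s IH] x; first by rewrite /=; case: ifP.
rewrite rcons_cons => xzs; have := xzs; rewrite cons_uniq => /andP[xn zs].
rewrite /= cat_uniq /= IH // mem_subdivide_path.
have -> : z \notin s.
  by move: zs; rewrite /= mem_rcons inE negb_or => /andP[/andP[]].
(* If the first edge is [uv], a second [None] would need both [u] and [v] after [x], yet [x] is one
   of them and does not recur. *)
case: eqP => [/set2_mem[xu _ _ _]|_] /=; rewrite andbT; last by apply/hasPn.
apply/hasPn => a aS; rewrite inE; apply: contra xn => /eqP e.
have /None_subdivide_path[us vs] : None \in subdivide_path u v z s y by rewrite -e.
by case/set2P: xu => ->.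
Qed.

Lemma subdivide_path_path (G : sgraph) (u v : G) x s y :
  path (@adj G) x (rcons s y) ->
  path (subdivide_rel u v) (Some x) (rcons (subdivide_path u v x s y) (Some y)).
Proof.
elim: s x => [|z s IH] x /=.
  by rewrite andbT => xy; case: eqP => [/set2_mem[xu yu _ _]|/eqP e] /=; rewrite ?xu ?yu // xy e.
by case/andP=> xz /IH p; case: eqP => [/set2_mem[xu zu _ _]|/eqP e] /=;
  rewrite p ?xu ?zu // xz e.
Qed.

Lemma size_subdivide_path (G : sgraph) (u v : G) x s y :
  size s <= size (subdivide_path u v x s y).
Proof. by elim: s x => [|z s IH] x //=; rewrite size_cat /=; have := IH z; lia. Qed.

Lemma size_subdivide_path_head (G : sgraph) (x y : G) s :
  size s < size (subdivide_path x (head y s) x s y).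
Proof.
case: s => [|z s] /=; rewrite eqxx //= !ltnS; exact: size_subdivide_path.
Qed.

(** The point to check is that [None] lies on one path only. If it lies on two, so do [u] and [v];
    when the paths share no inner vertex, these are two distinct common branch vertices, hence the
    paths have the same ends. *)
Lemma k4_model_subdivide (G : sgraph) (u v : G) b (p : 'I_4 -> 'I_4 -> seq G) :
  k4_model b p -> adj u v ->
  k4_model (G := subdivide_edge u v) (fun i => Some (b i))
    (fun i j => subdivide_path u v (b i) (p i j) (b j)).
Proof.
move=> [binj prev pp bp pdis] uv.
have nuv : u != v by apply: contraTneq uv => ->; rewrite adj_irrefl.
have bN i j : (b i == b j) = (i == j) by rewrite (inj_eq binj).
have Nij i j : i != j -> None \in subdivide_path u v (b i) (p i j) (b j) ->
    forall x, x \in [set u; v] -> x \in p i j \/ exists2 m, x = b m & m \in [set i; j].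
  move=> ij /None_subdivide_path[ue ve] x xuv.
  have : x \in b i :: rcons (p i j) (b j) by case/set2P: xuv => ->.
  rewrite inE mem_rcons inE => /or3P[/eqP->|/eqP->|]; [right|right|by left].
    by exists i; rewrite ?set21.
  by exists j; rewrite ?set22.
split.
- by move=> i j [/binj].
- by move=> i j; rewrite prev subdivide_path_rev.
- move=> i j ij; have [p1 p2] := pp i j ij; split; first exact: subdivide_path_path.
  apply: subdivide_path_uniq; rewrite /= mem_rcons inE negb_or bN ij bp //=.
  by rewrite rcons_uniq bp.
- by move=> i j k ij; rewrite mem_subdivide_path bp.
- move=> i j k l [x|] ij kl; first by rewrite !mem_subdivide_path; apply: pdis.
  move=> /(Nij _ _ ij) n1 /(Nij _ _ kl) n2.
  case: (pselect (exists2 x, x \in p i j & x \in p k l)) => [[x]|no]; first exact: pdis.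
  have br x : x \in [set u; v] -> exists m, [/\ x = b m, m \in [set i; j] & m \in [set k; l]].
    move=> xuv; case: (n1 _ xuv) (n2 _ xuv) => [x1|[m xm m1]] [x2|[m' xm' m2]].
    + by case: no; exists x.
    + by move: x1; rewrite xm' (negPf (bp _ _ _ ij)).
    + by move: x2; rewrite xm (negPf (bp _ _ _ kl)).
    + by exists m; split=> //; move: m2; rewrite -(binj _ _ (etrans (esym xm) xm')).
  have [m [um m1 m2]] := br u (set21 _ _); have [n [vn n1' n2']] := br v (set22 _ _).
  have mn : m != n by rewrite -bN -um -vn.
  case/set2P: m1 => e1; case/set2P: m2 => e2; case/set2P: n1' => e3; case/set2P: n2' => e4;
    by [case/eqP: mn; congruence | left; split; congruence | right; split; congruence].
Qed.

Lemma k4_model_subdivision (G H : sgraph) b (p : 'I_4 -> 'I_4 -> seq G) :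
  subdivision G H -> k4_model b p ->
  exists b' (p' : 'I_4 -> 'I_4 -> seq H),
    k4_model b' p' /\ forall i j, size (p i j) <= size (p' i j).
Proof.
move=> GH Mp; elim: GH => [|H' u v _ [b' [p' [Mp' sz]]] uv]; first by exists b, p.
have := k4_model_subdivide Mp' uv; set p'' := (p in k4_model _ p) => Mp''.
exists (fun i => Some (b' i)), p''; split=> // i j.
exact: leq_trans (sz i j) (size_subdivide_path _ _ _ _ _).
Qed.

Lemma k4_model_lengthen (G : sgraph) b (p : 'I_4 -> 'I_4 -> seq G) n (r : seq ('I_4 * 'I_4)) :
  k4_model b p -> (forall ij, ij \in r -> ij.1 != ij.2) ->
  exists (H : sgraph) b' (p' : 'I_4 -> 'I_4 -> seq H),
    [/\ subdivision G H, k4_model b' p',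
        forall i j, size (p i j) <= size (p' i j) &
        forall ij, ij \in r -> n <= size (p' ij.1 ij.2)].
Proof.
move=> Mp; elim: r => [|[i j] r IH] rne.
  by exists G, b, p; split=> //; exact: Subdivision_refl.
have [|H [b' [p' [GH Mp' pp' big]]]] := IH; first by move=> x xr; apply: rne; rewrite inE xr orbT.
have {rne} ij : i != j by apply: (rne (i, j)); rewrite inE eqxx.
have grow k : exists (K : sgraph) c (t : 'I_4 -> 'I_4 -> seq K),
    [/\ subdivision H K, k4_model c t,
        forall i j, size (p' i j) <= size (t i j) & k <= size (t i j)].
  elim: k => [|k [K [c [t [HK Mt pt tn]]]]].
    by exists H, b', p'; split=> //; exact: Subdivision_refl.
  have [_ _ /(_ _ _ ij)[pij _] _ _] := Mt.
  (* The default [c j] of [head] is the correct neighbour when the path has no inner vertex. *)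
  have ad : adj (c i) (head (c j) (t i j)) by case: (t i j) pij => [|z s] /= /andP[].
  exists (subdivide_edge (c i) (head (c j) (t i j))), (fun i => Some (c i)).
  exists (fun x y => subdivide_path (c i) (head (c j) (t i j)) (c x) (t x y) (c y)).
  split.
  - exact: Subdivision_edge.
  - exact: k4_model_subdivide.
  - by move=> x y; apply: leq_trans (pt x y) (size_subdivide_path _ _ _ _ _).
  - exact: leq_ltn_trans tn (size_subdivide_path_head _ _ _).
have [K [c [t [HK Mt pt tn]]]] := grow n.
exists K, c, t; split=> //; first exact: subdivision_trans HK.
  by move=> x y; apply: leq_trans (pp' x y) (pt x y).
move=> xy; rewrite inE => /orP[/eqP-> //|/big h]; exact: leq_trans h (pt _ _).
Qed.

Theorem theorem7p2 : 4 <= topological_inspection_number (complete_graph 4).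
Proof.
rewrite /topological_inspection_number; case: ex_minnP => m /asboolP bnd _.
(* Two inner vertices on every edge are what the balancing of lengths requires; every further
   subdivision keeps them. *)
have [H [b [p [GH Mp _ big]]]] := k4_model_lengthen 2
  (r := [seq ij <- enum {: 'I_4 * 'I_4} | ij.1 != ij.2]) k4_model_complete
  (fun ij => fun h => proj1 (andP (etrans (esym (mem_filter _ _ _)) h))).
have [H' HH' im] := bnd H GH.
have [b' [p' [Mp' pp']]] := k4_model_subdivision HH' Mp.
rewrite leqNgt; apply/negP => m3.
move: im; rewrite /inspection_number; case: ex_minnP => k /asboolP[s cs /allP sk] _ km.
have s3 : all (fun A : {set H'} => #|A| <= 3) s.
  by apply/allP => A /sk/eqP->; exact: leq_trans km m3.
apply: (k4_model_evasion Mp' _ s3 cs) => i j ij.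
apply: leq_trans (pp' i j); apply: (big (i, j)).
by rewrite mem_filter ij mem_enum.
Qed.
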